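(* Let $\mathcal{A}$ be an uncountable almost disjoint family of infinite subsets of $\mathbb{N}$, let $X$ be the one-point compactification of the Isbell-Mrówka space $\Psi(\mathcal{A})$, and let $Y$ be a compact scattered space. Then every semi-embedding $T:C_p(X)\to C_p(Y)$ is an embedding, but $X$ is not Eberlein compact.
   Context: Compact spaces are Hausdorff. A space is scattered if every non-empty subspace of it has an isolated point. $C_p(X)$ denotes the vector space of continuous real-valued functions on $X$ endowed with the topology of pointwise convergence. A family $\mathcal{A}$ of infinite subsets of $\mathbb{N}$ is almost disjoint if $A\cap B$ is finite for all distinct $A,B\in\mathcal{A}$. The Isbell-Mrówka space $\Psi(\mathcal{A})$ is the set $\mathbb{N}\cup\mathcal{A}$ topologized so that points of $\mathbb{N}$ are isolated and basic neighbourhoods of $A\in\mathcal{A}$ are the sets $\{A\}\cup(A\setminus F)$ with $F\subset\mathbb{N}$ finite; it is a locally compact Hausdorff space. A compact space is Eberlein compact if it is homeomorphic to a weakly compact subset of a Banach space. Let $E,F$ be locally convex spaces and $T:E\to F$ a continuous linear map. $T$ is polar if there exists in $E$ a base $\mathcal{U}$ of closed neighbourhoods of zero such that $T(U)$ is closed in $F$ for each $U\in\mathcal{U}$. $T$ is a semi-embedding if it is polar and injective. $T$ is an embedding if it is an isomorphism (linear homeomorphism) onto its range with the topology inherited from $F$. *)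

(* Defs.v *)
From HB Require Import structures.
From mathcomp Require Import all_boot all_order all_algebra.
From mathcomp Require Import all_classical all_reals.
From mathcomp Require Import topology normedtype convex.

Set Implicit Arguments.
Unset Strict Implicit.
Unset Printing Implicit Defensive.

Import Order.TTheory GRing.Theory Num.Theory.
Import numFieldTopology.Exports numFieldNormedType.Exports.

Local Open Scope classical_set_scope.
Local Open Scope ring_scope.

Definition homeomorphism (X Y : topologicalType) (f : X -> Y) : Prop :=
  exists g : Y -> X,
    [/\ continuous f, continuous g, cancel f g & cancel g f].

Definition homeomorphic (X Y : topologicalType) : Prop :=
  exists f : X -> Y, homeomorphism f.

Definition scattered (X : topologicalType) : Prop :=
  forall S : set X, S !=set0 -> isolated S !=set0.

Definition almost_disjoint (A : set (set nat)) : Prop :=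
  (forall B, A B -> infinite_set B) /\
  (forall B C, A B -> A C -> B <> C -> finite_set (B `&` C)).

(* The Isbell-Mrowka space of A: inl n is the point n of N, and inr B the point
   B of A, where the second summand is A coerced to the type of its elements. *)
Definition mrowka (A : set (set nat)) : Type := (nat + A)%type.

Section mrowka_topology.
Variable A : set (set nat).

HB.instance Definition _ := Choice.on (mrowka A).

Definition mrowka_nbhs (p : mrowka A) : set_system (mrowka A) :=
  match p with
  | inl n => [set U | U (inl n)]
  | inr B => filter_from (@finite_set nat)
      (fun F => [set inr B] `|` inl @` (set_val B `\` F))
  end.

Let mrowka_filter (p : mrowka A) : ProperFilter (mrowka_nbhs p).
Proof.
case: p => [n|B] /=.
  apply: Build_ProperFilter_ex; first by move=> P Pn; exists (inl n).
  by split=> //= P Q PQ; exact: PQ.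
apply: filter_from_proper; last by move=> F _; exists (inr B); left.
apply: filter_from_filter; first by exists set0; exact: finite_set0.
move=> F G finF finG; exists (F `|` G); first by rewrite finite_setU.
move=> q [->|[n [Bn /not_orP[nF nG]] <-]]; first by split; left.
by split; right; exists n.
Qed.

Let mrowka_singleton (p : mrowka A) U : mrowka_nbhs p U -> U p.
Proof. by case: p => [n|B] //= [F _]; apply; left. Qed.

Let mrowka_nbhs_nbhs (p : mrowka A) U :
  mrowka_nbhs p U -> mrowka_nbhs p (mrowka_nbhs^~ U).
Proof.
case: p => [n|B] //= [F finF sU]; exists F => // _ [->|[n Fn <-]] /=.
  by exists F.
by apply: sU; right; exists n.
Qed.

HB.instance Definition _ := hasNbhs.Build (mrowka A) mrowka_nbhs.
HB.instance Definition _ := @Nbhs_isNbhsTopological.Build (mrowka A)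
  mrowka_filter mrowka_singleton mrowka_nbhs_nbhs.

End mrowka_topology.

(* The alias gives continuousType its pointwise linear structure and the topology
   of pointwise convergence. *)
Definition Cp (R : realType) (X : topologicalType) : Type :=
  continuousType X R^o.

Section Cp_lmodType.
Variables (R : realType) (X : topologicalType).
Local Notation E := (Cp R X).

HB.instance Definition _ := Choice.on E.

Definition Cp_fun (f : E) : X -> R^o := f.

Lemma Cp_funP (f g : E) : Cp_fun f =1 Cp_fun g -> f = g.
Proof. by move=> fg; exact/continuousEP. Qed.

Let cst_cts : continuous (fun _ : X => 0 : R^o).
Proof. exact: cst_continuous. Qed.

Let opp_cts (f : E) : continuous (fun x => - Cp_fun f x).
Proof. by move=> x; apply: cvgN; exact: cts_fun. Qed.

Let add_cts (f g : E) : continuous (fun x => Cp_fun f x + Cp_fun g x).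
Proof. by move=> x; apply: cvgD; exact: cts_fun. Qed.

Let scale_cts (a : R) (f : E) : continuous (fun x => a *: Cp_fun f x).
Proof. by move=> x; apply: cvgZr; exact: cts_fun. Qed.

Definition Cp_zero : E := mkcts cst_cts.
Definition Cp_opp (f : E) : E := mkcts (@opp_cts f).
Definition Cp_add (f g : E) : E := mkcts (@add_cts f g).
Definition Cp_scale (a : R) (f : E) : E := mkcts (@scale_cts a f).

Let Cp_addA : associative Cp_add.
Proof. by move=> f g h; apply: Cp_funP => x; exact: addrA. Qed.
Let Cp_addC : commutative Cp_add.
Proof. by move=> f g; apply: Cp_funP => x; exact: addrC. Qed.
Let Cp_add0 : left_id Cp_zero Cp_add.
Proof. by move=> f; apply: Cp_funP => x; exact: add0r. Qed.
Let Cp_addN : left_inverse Cp_zero Cp_opp Cp_add.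
Proof. by move=> f; apply: Cp_funP => x; exact: addNr. Qed.

HB.instance Definition _ :=
  GRing.isZmodule.Build E Cp_addA Cp_addC Cp_add0 Cp_addN.

Let Cp_scaleA a b (f : E) : Cp_scale a (Cp_scale b f) = Cp_scale (a * b) f.
Proof. by apply: Cp_funP => x; exact: scalerA. Qed.
Let Cp_scale1 : left_id 1 Cp_scale.
Proof. by move=> f; apply: Cp_funP => x; exact: scale1r. Qed.
Let Cp_scaleDr : right_distributive Cp_scale +%R.
Proof. by move=> a f g; apply: Cp_funP => x; exact: scalerDr. Qed.
Let Cp_scaleDl (f : E) : {morph Cp_scale^~ f : a b / a + b}.
Proof. by move=> a b; apply: Cp_funP => x; exact: scalerDl. Qed.

HB.instance Definition _ := GRing.Zmodule_isLmodule.Build R E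
  Cp_scaleA Cp_scale1 Cp_scaleDr Cp_scaleDl.

Lemma CpD (f g : E) x : Cp_fun (f + g) x = Cp_fun f x + Cp_fun g x.
Proof. by []. Qed.

Lemma CpZ a (f : E) x : Cp_fun (a *: f) x = a *: Cp_fun f x.
Proof. by []. Qed.

End Cp_lmodType.

Section Cp_tvsType.
Variables (R : realType) (X : topologicalType).
Local Notation E := (Cp R X).

HB.instance Definition _ := Uniform.copy E
  (initial_topology (@Cp_fun R X : E -> {ptws X -> R^o})).

Lemma Cp_cvgP (F : set_system E) (f : E) : Filter F ->
  F --> f <-> forall x, Cp_fun g x @[g --> F] --> Cp_fun f x.
Proof.
move=> FF; have evF : Filter (@Cp_fun R X @ F) by exact: fmap_filter.
have := @pointwise_cvgP _ _ (@Cp_fun R X @ F) (Cp_fun f) evF => evP.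
split=> [Ff|Ff].
  apply/evP; apply: cvg_trans (cvg_app _ Ff) _.
  exact: (@initial_continuous _ _ (@Cp_fun R X : E -> {ptws X -> R^o})).
move=> U [_ [[V oV <-] Vf VU]].
apply: filterS VU _; apply: (evP.2 Ff); exact: open_nbhs_nbhs.
Qed.

Lemma Cp_fun_cvg (f : E) x : Cp_fun g x @[g --> f] --> Cp_fun f x.
Proof. exact: ((Cp_cvgP f (nbhs_filter f)).1 (@cvg_id _ (nbhs f))). Qed.

Let Cp_add_continuous : continuous (fun fg : E * E => fg.1 + fg.2).
Proof.
move=> [f g]; apply/Cp_cvgP => x.
apply: (@cvgD _ R^o (E * E)%type (nbhs (f, g)) _ (fun fg => Cp_fun fg.1 x)
  (fun fg => Cp_fun fg.2 x)).
- exact: (cvg_comp fst (fun h : E => Cp_fun h x) cvg_fst (@Cp_fun_cvg f x)).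
- exact: (cvg_comp snd (fun h : E => Cp_fun h x) cvg_snd (@Cp_fun_cvg g x)).
Qed.

Let Cp_scale_continuous : continuous (fun af : R^o * E => af.1 *: af.2).
Proof.
move=> [a f]; apply/Cp_cvgP => x.
apply: (@cvgZ _ R^o (R^o * E)%type (nbhs (a, f)) _ (fun af => af.1)
  (fun af => Cp_fun af.2 x)); first exact: cvg_fst.
exact: (cvg_comp snd (fun h : E => Cp_fun h x) cvg_snd (@Cp_fun_cvg f x)).
Qed.

Let Cp_locally_convex :
  exists2 B : set_system E, (forall b, b \in B -> convex_set b) & basis B.
Proof.
exists [set U | open U /\ convex_set U] => [b /set_mem[]//|].
split=> [b []//|f].
set G := filter_from _ _.
have FG : Filter G.
  apply: filter_from_filter.
    exists setT; split=> //; split; first exact: openT.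
    by move=> *; rewrite in_setT.
  move=> P Q [[oP cP] Pf] [[oQ cQ] Qf]; exists (P `&` Q) => //.
  split=> //; split; first exact: openI.
  move=> g h l /set_mem[Pg Qg] /set_mem[Ph Qh]; apply/mem_set; split.
    by apply/set_mem/cP; exact/mem_set.
  by apply/set_mem/cQ; exact/mem_set.
apply/Cp_cvgP => x U fxU.
have [B cB [oB /(_ (Cp_fun f x) U fxU) [b [Bb bfx] bU]]] := @locally_convex R R^o.
exists ((fun g : E => Cp_fun g x) @^-1` b); last by move=> g /= /bU.
split=> //; split.
  by apply: open_comp (oB _ Bb) => g _; exact: Cp_fun_cvg.
move=> g h l /set_mem /= gx /set_mem /= hx; apply/mem_set => /=.
by apply/set_mem; apply: (cB b _ (Cp_fun g x) (Cp_fun h x) l); exact/mem_set.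
Qed.

HB.instance Definition _ :=
  PreTopologicalNmodule_isTopologicalNmodule.Build E Cp_add_continuous.
HB.instance Definition _ :=
  TopologicalNmodule_isTopologicalLmodule.Build R E Cp_scale_continuous.
HB.instance Definition _ := Uniform_isTvs.Build R E Cp_locally_convex.

End Cp_tvsType.

Section semi_embeddings.
Variables (R : realType) (E F : tvsType R).
Implicit Type T : {linear E -> F}.

(* Continuity of T is not part of polar and semi_embedding: it is to be assumed
   separately. *)
Definition polar T : Prop :=
  exists U : set_system E,
    [/\ forall A, U A -> nbhs 0 A /\ closed A,
        forall V, nbhs 0 V -> exists2 A, U A & A `<=` V &
        forall A, U A -> closed (T @` A)].

Definition semi_embedding T : Prop := polar T /\ injective T.

Definition corestriction T (x : E) : range T :=
  SigSub (mem_set (imageT T x)).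

(* The corestriction is linear and onto, and range T has the subspace topology of
   F, so this says that T is a linear homeomorphism onto its range. *)
Definition embedding T : Prop := homeomorphism (corestriction T).

End semi_embeddings.

Definition continuous_functional (R : realType) (E : normedModType R) : Type :=
  {phi : {linear E -> R^o} | continuous phi}.

(* E with its weak topology: the initial topology for the continuous linear
   functionals on E. *)
Definition weak_space (R : realType) (E : normedModType R) : Type :=
  sup_topology (fun phi : continuous_functional E =>
    Topological.class (initial_topology (sval phi : E -> R^o))).

HB.instance Definition _ (R : realType) (E : normedModType R) :=
  Topological.on (weak_space E).

(* K is compact for the weak topology, and as the codomain of the homeomorphism it
   is coerced to a type, with the subspace topology of the weak topology. *)
Definition eberlein_compact (R : realType) (X : topologicalType) : Prop :=
  exists (E : completeNormedModType R) (K : set (weak_space E)),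
    compact K /\ homeomorphic X K.

(* Main.v *)
From HB Require Import structures.
Require Import Defs.
From mathcomp Require Import all_boot all_order all_algebra.
From mathcomp Require Import all_classical all_reals.
From mathcomp Require Import topology normedtype.
From mathcomp Require Import lra finmap.

(** The theorem has two independent halves.

Semi-embeddings. The map T is an embedding as soon as every evaluation f(x) is
a finite linear combination of the values (T f)(y), for then f is recovered from
T f continuously for pointwise convergence. By linear algebra
([kernel_combination]), it is enough that for every x there is a finite set P of
points of Y such that T w = 0 on P forces w(x) = 0
([semi_embedding_determined]). Suppose that this fails at x. Polarity gives a
neighbourhood U of 0, contained in the set of the f with |f(x)| < 1, such that
T(U) is closed, and U contains every function that vanishes on a certain finite
set G. As functions killed by T on P can take the value 1 at x for every finite
P, one extends this prescription one point at a time
([interpolable_cons]) to obtain a function g with g(x) = 1 such that for every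
finite P some w agrees with g on G while T w vanishes on P. The functions g - w
lie in U and their images agree with T g on P, so T g is in the closure of T(U).
Hence T g is in T(U), and injectivity puts g in U although g(x) = 1.

Failure of Eberlein compactness. The space X is separable: N is dense in
Psi(A), so N and the point at infinity are dense in X. If X were a weakly
compact set in a normed space, then by Hahn-Banach it would lie in the closed
span of this countable set, where countably many functionals, each norming one
rational combination, separate the points ([countable_separation]). A compact
space on which countably many continuous real functions separate points has only
countable discrete subspaces ([countable_discrete]), and A is a discrete
subspace of X, so A would be countable.

Hahn-Banach is obtained in the form: for sublinear p and a vector v there is a
linear f <= p with f(v) = p(v) ([hahn_banach]). It follows from Zorn's lemma
applied to sublinear functions rather than to partial linear maps, because
a minimal sublinear function is linear. *)

Set Implicit Arguments.
Unset Strict Implicit.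
Unset Printing Implicit Defensive.

Import Order.TTheory GRing.Theory Num.Theory.
Import numFieldTopology.Exports numFieldNormedType.Exports.

Local Open Scope classical_set_scope.
Local Open Scope ring_scope.

(** * Linear forms and interpolation *)

Section linear_forms.
Variables (R : fieldType) (E : lmodType R).

(** By induction on [s]: if some [w0] in the kernel of the other forms is not
killed by [phi i], subtracting the right multiple of [phi i] from [e] makes it
vanish at [w0], and every vector killed by the other forms is, modulo [w0], in
the kernel of [phi i] too. If there is no such [w0], [phi i] vanishes wherever
the other forms do, and receives the coefficient 0. *)
Lemma kernel_combination (I : eqType) (phi : I -> {scalar E}) (s : seq I)
    (e : E -> R) : scalar e ->
  (forall w, {in s, forall i, phi i w = 0} -> e w = 0) ->
  exists c : seq R, forall w, e w = \sum_(p <- zip c s) p.1 * phi p.2 w.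
Proof.
elim: s e => [|i s IH] e lin_e ker_e.
  by exists [::] => w; rewrite big_nil; exact: ker_e.
have [[w0 [w0s w0i]]|no_w0] :=
    pselect (exists w0, {in s, forall j, phi j w0 = 0} /\ phi i w0 != 0).
  pose c0 := e w0 / phi i w0.
  have [|w ws|c ec] := IH (fun w => e w - c0 * phi i w).
  - by move=> a u v; rewrite lin_e linearP/= mulrDr mulrBr mulrCA opprD addrACA.
  - have /ker_e : {in i :: s, forall j,
        phi j (- (phi i w / phi i w0) *: w0 + w) = 0}.
      move=> j; rewrite inE linearP /= => /predU1P[->|js].
        by rewrite mulNr divfK// addNr.
      by rewrite (ws _ js) (w0s _ js) mulr0 addr0.
    rewrite lin_e /c0 => /eqP; rewrite mulNr addrC subr_eq0 => /eqP ->.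
    by rewrite mulrAC [phi i w * _]mulrC [X in _ - X]mulrAC subrr.
  exists (c0 :: c) => w; rewrite /= big_cons -ec /=.
  by rewrite addrC subrK.
have [//|w ws|c ec] := IH e; last first.
  by exists (0 :: c) => w; rewrite big_cons mul0r add0r.
apply: ker_e => j; rewrite inE => /predU1P[->|/ws//].
by apply/eqP/negPn/negP => wi; apply: no_w0; exists w.
Qed.

Variables (I J : eqType) (e : I -> {scalar E}) (phi : J -> {scalar E}).

(** As [P] is an arbitrary finite set, this says that the values [e i g], for
[i] in [G], are compatible with all the equations [phi j = 0] together: a linear
functional on the span of all these forms takes these values at the [e i] and
vanishes at every [phi j]. *)
Definition interpolable (G : seq I) (g : E) :=
  forall P : seq J, exists w : E,
    {in G, forall i, e i w = e i g} /\ {in P, forall j, phi j w = 0}.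

(** Either finitely many of the equations already force the value of the new
form [e i], and that value is kept, as it is then compatible with any further
equations; or they never do, and then any value is compatible. *)
Lemma interpolable_cons (i : I) (G : seq I) (g : E) : interpolable G g ->
  exists g' : E, interpolable (i :: G) g' /\ {in G, forall k, e k g' = e k g}.
Proof.
move=> gG.
have [[P0 detP0]|free] := pselect (exists P0 : seq J, forall w,
    {in G, forall k, e k w = 0} -> {in P0, forall j, phi j w = 0} -> e i w = 0).
  have [g' [g'G g'P0]] := gG P0; exists g'; split=> // P.
  have [w [wG wP]] := gG (P0 ++ P); exists w; split=> [k|j jP]; last first.
    by apply: wP; rewrite mem_cat jP orbT.
  rewrite inE => /predU1P[->|kG]; last by rewrite wG// g'G.
  apply/eqP; rewrite -subr_eq0 -linearB; apply/eqP/detP0 => [l lG|j jP0].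
    by rewrite linearB/= (wG _ lG) (g'G _ lG) subrr.
  by rewrite linearB/= g'P0// wP ?subrr// mem_cat jP0.
(* The value of [e i] is free, so that of [g] itself can be kept. *)
exists g; split=> // P; have [w [wG wP]] := gG P.
have [v [vG vP vi]] : exists v, [/\ {in G, forall k, e k v = 0},
    {in P, forall j, phi j v = 0} & e i v != 0].
  apply: contrapT => nov; apply: free; exists P => v vG vP.
  by apply/eqP/negPn/negP => vi; apply: nov; exists v.
exists (w + ((e i g - e i w) / e i v) *: v); split=> [k|j jP].
  rewrite inE linearD linearZ/= => /predU1P[->|kG].
    by rewrite divfK// addrC subrK.
  by rewrite (vG _ kG) mulr0 addr0 wG.
by rewrite linearD linearZ/= (wP _ jP) (vP _ jP) mulr0 addr0.
Qed.

Lemma interpolable_cat (G' G : seq I) (g : E) : interpolable G g ->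
  exists g' : E,
    interpolable (G' ++ G) g' /\ {in G, forall k, e k g' = e k g}.
Proof.
move=> gG; elim: G' => [|i G' [g' [g'G' g'G]]]; first by exists g.
have [g'' [g''G' g''G]] := interpolable_cons i g'G'.
by exists g''; split=> // k kG; rewrite g''G ?g'G// mem_cat kG orbT.
Qed.

End linear_forms.

(** * Semi-embeddings between spaces of continuous functions *)

Section Cp_evaluation.
Variables (R : realType) (X : topologicalType).
Local Notation E := (Cp R X).

(** A name on which evaluation at a point carries its linear structure. *)
Definition Cp_eval (x : X) (f : E) : R := Cp_fun f x.

Let Cp_eval_linear x : scalar (Cp_eval x).
Proof. by move=> a f g; rewrite /Cp_eval CpD CpZ. Qed.

HB.instance Definition _ x :=
  GRing.isLinear.Build R E R *%R (Cp_eval x) (@Cp_eval_linear x).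

(** The sets of functions that agree with [f] on a finite set generate a filter
which converges to [f], since it does so at each point. *)
Lemma nbhs_Cp (f : E) (U : set E) : nbhs f U ->
  exists P : seq X,
    forall g, {in P, forall x, Cp_eval x g = Cp_eval x f} -> U g.
Proof.
pose F : set_system E := filter_from [set: seq X]
  (fun P => [set g | {in P, forall x, Cp_eval x g = Cp_eval x f}]).
have FF : Filter F.
  apply: filter_from_filter => [|P Q _ _]; first by exists [::].
  exists (P ++ Q) => // g gPQ.
  by split=> x xs; apply: gPQ; rewrite mem_cat xs ?orbT.
have /(_ U) : F --> f.
  apply/Cp_cvgP => x V Vfx; exists [:: x] => // g /= gx.
  rewrite -/(Cp_eval x g) gx ?mem_head//; exact: nbhs_singleton Vfx.
by move=> + fU => /(_ fU)[P _ PU]; exists P.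
Qed.

End Cp_evaluation.

Section semi_embedding_Cp.
Variables (R : realType) (X Y : topologicalType).
Variable T : {linear Cp R X -> Cp R Y}.
Hypothesis T_semi : semi_embedding T.

(** If finitely many values of [T w] never force [w] to vanish at [x], then
interpolation produces [g] outside a neighbourhood [A] of 0 from the polar base
whose image [T g] is nevertheless a limit of points of [T @` A]. *)
Lemma semi_embedding_determined (x : X) :
  exists P : seq Y, forall w,
    {in P, forall y, Cp_eval y (T w) = 0} -> Cp_eval x w = 0.
Proof.
apply: contrapT => nP.
pose phi y : {scalar Cp R X} := Cp_eval y \o T.
have [[U [Ucl Ubase TU]] Tinj] := T_semi.
have [g0 g0x] : exists g0 : Cp R X, Cp_eval x g0 = 1.
  apply: contrapT => ng; apply: nP; exists [::] => w _.
  apply/eqP/negPn/negP => wx; apply: ng; exists ((Cp_eval x w)^-1 *: w).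
  by rewrite linearZ/= mulVf.
have g0P : interpolable (@Cp_eval R X) phi [:: x] g0.
  move=> P; apply: contrapT => nw; apply: nP; exists P => w wP.
  apply/eqP/negPn/negP => wx; apply: nw; exists ((Cp_eval x w)^-1 *: w).
  split=> [k|y yP]; first by rewrite inE linearZ/= => /eqP ->; rewrite mulVf.
  by rewrite linearZ /= (_ : Cp_eval y (T w) = 0) ?mulr0 ?wP.
have [A UA Ax] : exists2 A, U A & A `<=` [set f | `|Cp_eval x f| < 1].
  apply: Ubase; have := @Cp_fun_cvg R X 0 x.
  move=> /(_ [set r | `|r| < 1]); apply => //=.
  apply/nbhs_ballP; exists 1 => //= r /=.
  by rewrite /ball /= sub0r normrN.
have [/nbhs_Cp[G GA] Acl] := Ucl _ UA.
(* [g] is to be out of [A] because of its value at [x], but modulo functions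
   vanishing on [G], which are in [A], it is killed by any finite set of the
   forms [phi y]. *)
have [g [gP gx]] := interpolable_cat G g0P.
have {}gx : Cp_eval x g = 1 by rewrite -g0x; exact: gx (mem_head _ _).
have gA : ~ A g by move/Ax => /=; rewrite gx normr1 ltxx.
have : ~ (T @` A) (T g) by move=> [h Ah /Tinj hg]; apply: gA; rewrite -hg.
have : open (~` (T @` A)) by exact/closed_openC/TU.
rewrite openE => /[apply] /nbhs_Cp[P PA].
have [w [wG wP]] := gP P.
apply: (PA (T (g - w))).
  by move=> y yP; rewrite !linearB/= [X in _ - X](wP y yP) subr0.
exists (g - w) => //; apply: GA => k kG.
by rewrite linearB linear0/=; apply/eqP; rewrite subr_eq0 wG// mem_cat kG.
Qed.

Lemma semi_embedding_Cp : continuous T -> embedding T.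
Proof.
move=> Tcont; have [_ Tinj] := T_semi.
have Tpre (z : range T) : exists f, T f = set_val z.
  by have [f _ fz] := set_mem (valP z); exists f.
pose S z := projT1 (cid (Tpre z)).
have TS z : T (S z) = set_val z by rewrite /S; case: cid.
exists S; split.
- apply: continuous_comp_initial => f; exact: Tcont.
- move=> z; apply/(Cp_cvgP _ (fmap_filter S (nbhs_filter z))) => x.
  have [P xP] := semi_embedding_determined x.
  pose phi y : {scalar Cp R X} := Cp_eval y \o T.
  have [c ec] :=
    @kernel_combination _ _ _ phi P _ (@linearP _ _ _ _ (Cp_eval x)) xP.
  rewrite -/(Cp_eval x (S z)) ec.
  under eq_fun do rewrite -/(Cp_eval x _) ec.
  apply: (@cvg_big R^o) => [|[a y] _ /=]; first exact: add_continuous.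
  apply: (@cvgMl_tmp R); rewrite /phi /= TS.
  suff : Cp_eval y (T (S t)) @[t --> z] --> Cp_eval y (set_val z) by [].
  rewrite (_ : (fun t => _) = Cp_eval y \o set_val); last first.
    by apply/funext => t; rewrite /= TS.
  apply: (cvg_comp (set_val : range T -> Cp R Y)); last exact: Cp_fun_cvg.
  exact: initial_continuous.
- by move=> f; apply: Tinj; rewrite TS.
- by move=> z; apply: val_inj; rewrite /= TS.
Qed.

End semi_embedding_Cp.

(** * Sublinear functions and the Hahn-Banach theorem *)

Section sublinear.
Variables (R : realType) (E : lmodType R).

(** Positive homogeneity is asked as an inequality, which is what infima of
families satisfy at once; applied to the inverse of the factor it gives
[sublinearZ]. *)
Definition sublinear (p : E -> R) :=
  (forall u v, p (u + v) <= p u + p v) /\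
  (forall a u, 0 < a -> p (a *: u) <= a * p u).

Lemma sublinear0 (p : E -> R) : sublinear p -> p 0 = 0.
Proof.
move=> [_ pZ]; have := pZ 2 0 (ltr0Sn _ _); have := pZ 2^-1 0.
rewrite !scaler0 invr_gt0 ltr0n => /(_ isT); lra.
Qed.

Lemma sublinearZ (p : E -> R) a u : sublinear p -> 0 <= a ->
  p (a *: u) = a * p u.
Proof.
move=> sp; rewrite le_eqVlt => /predU1P[<-|a0].
  by rewrite scale0r mul0r sublinear0.
have pZ := sp.2; apply/eqP; rewrite eq_le pZ//= -ler_pdivlMl//.
by rewrite -{1}[u](scalerK (lt0r_neq0 a0)) pZ// invr_gt0.
Qed.

Lemma sublinear_ge (p : E -> R) u : sublinear p -> - p (- u) <= p u.
Proof.
by move=> sp; have := sp.1 u (- u); rewrite subrr sublinear0// -lerBlDr sub0r.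
Qed.

(** The hypotheses ask that the family be directed downwards as far as sums and
multiples require; this covers chains of sublinear functions, [slide], and
the distance to a subspace. *)
Lemma sublinear_inf (I : Type) (D : set I) (f : I -> E -> R) :
    D !=set0 ->
    (forall u, has_lbound [set f i u | i in D]) ->
    (forall i j u v, D i -> D j ->
      exists2 k, D k & f k (u + v) <= f i u + f j v) ->
    (forall i a u, D i -> 0 < a ->
      exists2 k, D k & f k (a *: u) <= a * f i u) ->
  sublinear (fun u => inf [set f i u | i in D]).
Proof.
move=> [i0 Di0] lbD fD fZ.
have m_le i u : D i -> inf [set f i u | i in D] <= f i u.
  by move=> Di; apply: (ge_inf (lbD u)); exists i.
have le_m x u : (forall i, D i -> x <= f i u) -> x <= inf [set f i u | i in D].
  move=> xf; apply: lb_le_inf; first by exists (f i0 u), i0.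
  by move=> _ [i Di <-]; exact: xf.
split=> [u v|a u a0].
  rewrite -lerBlDr; apply: (le_m) => i Di; rewrite lerBlDr -lerBlDl.
  apply: (le_m) => j Dj; rewrite lerBlDl.
  by have [k Dk] := fD i j u v Di Dj; exact/le_trans/m_le.
rewrite -ler_pdivrMl//; apply: (le_m) => i Di; rewrite ler_pdivrMl//.
by have [k Dk] := fZ i a u Di a0; exact/le_trans/m_le.
Qed.

(** The function [slide p v] is the largest sublinear function below [p] whose
value at [- v] is at most [- p v], so that it is linear on the line of [v]. *)
Definition slide (p : E -> R) (v u : E) : R :=
  inf [set p (u + t *: v) - t * p v | t in [set t | 0 <= t]].

Section slide.
Variables (p : E -> R) (v : E).
Hypothesis sp : sublinear p.

Let slide_lb u :
  has_lbound [set p (u + t *: v) - t * p v | t in [set t | 0 <= t]].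
Proof.
exists (- p (- u)) => _ [t /= t0 <-]; rewrite lerBrDr addrC lerBlDr.
by rewrite -sublinearZ// (le_trans _ (sp.1 _ _))// addrC addKr.
Qed.

Lemma slide_sublinear : sublinear (slide p v).
Proof.
apply: (@sublinear_inf _ _ (fun t u => p (u + t *: v) - t * p v)) => //.
- by exists 0 => /=.
- move=> s t u w /= s0 t0; exists (s + t); first exact: addr_ge0.
  by rewrite mulrDl opprD addrACA lerD2r scalerDl addrACA; exact: sp.1.
- move=> t a u /= t0 a0; exists (a * t); first by rewrite mulr_ge0// ltW.
  by rewrite mulrBr mulrA lerD2r -scalerA -scalerDr; exact: sp.2.
Qed.

Lemma slide_le u : slide p v u <= p u.
Proof.
apply: (ge_inf (slide_lb u)); exists 0 => //=.
by rewrite scale0r mul0r addr0 subr0.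
Qed.

Lemma slideN : slide p v (- v) <= - p v.
Proof.
apply: (ge_inf (slide_lb _)); exists 1 => //=.
by rewrite scale1r mul1r addNr sublinear0// sub0r.
Qed.

End slide.

Lemma minimal_sublinear (p : E -> R) : sublinear p ->
  exists q, [/\ sublinear q, (forall u, q u <= p u) &
    forall r, sublinear r -> (forall u, r u <= q u) -> forall u, q u <= r u].
Proof.
move=> sp; pose T := {q : E -> R | sublinear q /\ forall u, q u <= p u}.
pose le (q r : T) := `[< forall u, sval r u <= sval q u >].
have [||C Ctot|[q [sq qp]] qmin] :=
  @ZL_preorder T (exist _ p (conj sp (fun=> lexx _))) le.
- by move=> q; apply/asboolP.
- move=> q r s /asboolP qr /asboolP rs; apply/asboolP => u.
  exact: le_trans (rs u) (qr u).
- have [C0|/set0P[q0 Cq0]] := eqVneq C set0.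
    by exists (exist _ p (conj sp (fun=> lexx _))) => s; rewrite C0.
  pose m u := inf [set sval q u | q in C].
  (* Members of the chain are bounded below because they are below [p]. *)
  have lbC u : has_lbound [set sval q u | q in C].
    exists (- p (- u)) => _ [[q [sq qp]] /= _ <-].
    by rewrite (le_trans _ (sublinear_ge _ sq))// lerN2.
  have mle q u : C q -> m u <= sval q u.
    by move=> Cq; apply: (ge_inf (lbC u)); exists q.
  have sm : sublinear m.
    apply: (@sublinear_inf T C (fun q => sval q)) => //; first by exists q0.
      move=> q r u v Cq Cr; have [/asboolP qr|/asboolP rq] := Ctot _ _ Cq Cr.
        exists r => //; apply: (le_trans ((svalP r).1.1 u v)).
        by rewrite lerD2r.
      exists q => //; apply: (le_trans ((svalP q).1.1 u v)).
      by rewrite lerD2l.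
    move=> q a u Cq a0; exists q => //; exact: (svalP q).1.2.
  have mp u : m u <= p u by exact: le_trans (mle q0 u Cq0) ((svalP q0).2 u).
  by exists (exist _ m (conj sm mp)) => q Cq; apply/asboolP => u; exact: mle.
exists q; split=> // r sr rq u.
have rp v : r v <= p v by exact: le_trans (rq v) (qp v).
by have /asboolP := qmin (exist _ r (conj sr rp)) (asboolT rq).
Qed.

(** Take [q] minimal below [slide p v]. For each [u], the function [slide q u]
is sublinear and below [q], hence equal to it, so that [q (- u) = - q u]; a
sublinear odd function is linear. Finally [q (- v) <= - p v] gives
[p v <= q v]. *)
Lemma hahn_banach (p : E -> R) (v : E) : sublinear p ->
  exists f : {linear E -> R^o}, (forall u, f u <= p u) /\ f v = p v.
Proof.
move=> sp; have [q [sq qp qmin]] := minimal_sublinear (slide_sublinear v sp).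
have qN u : q (- u) = - q u.
  apply/eqP; rewrite eq_le -lerNl (sublinear_ge u sq) andbT.
  apply: le_trans (slideN u sq); apply: qmin; first exact: slide_sublinear.
  exact: slide_le.
have qD u w : q (u + w) = q u + q w.
  apply/eqP; rewrite eq_le sq.1/= -lerN2 opprD -!qN opprD; exact: sq.1.
have qlin : linear (q : E -> R^o).
  move=> a u w; rewrite qD; congr (_ + _).
  have [a0|/ltW a0] := leP 0 a; first exact: sublinearZ.
  apply: oppr_inj; rewrite -qN -scaleNr sublinearZ ?oppr_ge0// mulNr //.
pose qm := GRing.isLinear.Build R E R^o *:%R q qlin.
pose f : {linear E -> R^o} := HB.pack q qm.
exists f; split=> [u|]; first exact: le_trans (qp u) (slide_le v sp u).
apply/eqP; rewrite eq_le (le_trans (qp v) (slide_le v sp v))/=.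
by rewrite -lerN2 -[- f v]qN (le_trans (qp _) (slideN v sp)).
Qed.

End sublinear.

(** * Countable separation of the points of a separable weakly compact set *)

Section separation.
Variables (R : realType) (E : normedModType R).

Lemma dominated_continuous (f : {linear E -> R^o}) :
  (forall u, f u <= `|u|) -> continuous f.
Proof.
move=> fle; apply/linear_bounded_continuous/linear_boundedP.
near=> r => u; apply: (@le_trans _ _ `|u|); last first.
  by rewrite ler_peMl//; near: r; exact: nbhs_pinfty_ge.
by rewrite ler_norml fle andbT lerNl -linearN -normrN fle.
Unshelve. all: by end_near. Qed.

Lemma norming_functional (v : E) :
  exists f : {linear E -> R^o}, (forall u, f u <= `|u|) /\ f v = `|v|.
Proof.
apply: (@hahn_banach R E (fun u => `|u|)); split=> [u w|a u a0].
  exact: ler_normD.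
by rewrite normrZ gtr0_norm.
Qed.

(** The distance to [S] is sublinear; a linear form below it that attains it at
[z] is nonpositive on the subspace [S], hence zero there. *)
Lemma separate_subspace (S : set E) (z : E) (e : R) :
    S 0 -> (forall u v, S u -> S v -> S (u + v)) ->
    (forall a u, S u -> S (a *: u)) ->
    0 < e -> (forall u, S u -> e <= `|z - u|) ->
  exists f : {linear E -> R^o},
    [/\ continuous f, forall u, S u -> f u = 0 & 0 < f z].
Proof.
move=> S0 SD SZ e0 ze.
pose p u := inf [set `|u - w| | w in S].
have lbp u : has_lbound [set `|u - w| | w in S].
  by exists 0 => _ [w _ <-]; exact: normr_ge0.
have ple u w : S w -> p u <= `|u - w|.
  by move=> Sw; apply: (ge_inf (lbp u)); exists w.
have sp : sublinear p.
  apply: (@sublinear_inf _ _ E S (fun w u => `|u - w|)) => //.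
  - by exists 0.
  - move=> s t u v Ss St; exists (s + t); first exact: SD.
    by rewrite opprD addrACA; exact: ler_normD.
  - move=> s a u Ss a0; exists (a *: s); first exact: SZ.
    by rewrite -scalerBr normrZ gtr0_norm.
have [f [fp fz]] := hahn_banach z sp; exists f; split.
- apply: dominated_continuous => u.
  by apply: le_trans (fp u) _; have := ple u 0 S0; rewrite subr0.
- have fle0 u : S u -> f u <= 0.
    move=> Su; apply: le_trans (fp u) _.
    by have := ple u u Su; rewrite subrr normr0.
  move=> u Su; apply/eqP; rewrite eq_le fle0//= -lerN2 oppr0 -linearN.
  by apply: fle0; rewrite -scaleN1r; exact: SZ.
- rewrite fz; apply: lt_le_trans e0 _; apply: lb_le_inf.
    by exists `|z - 0|, 0.
  by move=> _ [w Sw <-]; exact: ze.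
Qed.

Variables (X : topologicalType) (h : X -> E) (I : countType) (g : I -> X).
Hypothesis h_cont : forall f : {linear E -> R^o}, continuous f ->
  continuous (f \o h).
Hypothesis h_inj : injective h.
Hypothesis g_dense : closure (range g) = [set: X].

Let comb (s : seq (rat * I)) : E := \sum_(c <- s) ratr c.1 *: h (g c.2).

(** The rational combinations are countably many, but only their closure is
stable under real multiples; it is the closed linear span of the [h (g i)]. *)
Let span := [set v | forall e : R, 0 < e -> exists s, `|v - comb s| < e].

Let span_comb s : span (comb s).
Proof. by move=> e e0; exists s; rewrite subrr normr0. Qed.

Let spanD u v : span u -> span v -> span (u + v).
Proof.
move=> su sv e e0; have e20 : 0 < e / 2 by rewrite divr_gt0.
have [s us] := su _ e20; have [t vt] := sv _ e20; exists (s ++ t).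
rewrite /comb big_cat/= opprD addrACA (le_lt_trans (ler_normD _ _))//.
by rewrite (splitr e) ltrD.
Qed.

Let spanZ a u : span u -> span (a *: u).
Proof.
move=> su e e0; have e20 : 0 < e / 2 by rewrite divr_gt0.
have [|s us] := su (e / 2 / (`|a| + 1)); first by rewrite divr_gt0// ltr_wpDl.
pose d := e / 2 / (`|comb s| + 1).
have d0 : 0 < d by rewrite divr_gt0// ltr_wpDl.
have /rat_in_itvoo[q /itvP qa] : a < a + d by rewrite ltrDl.
exists [seq (q * c.1, c.2) | c <- s].
have -> : comb [seq (q * c.1, c.2) | c <- s] = ratr q *: comb s.
  rewrite /comb big_map scaler_sumr; apply: eq_bigr => c _ /=.
  by rewrite rmorphM scalerA.
rewrite -[a *: u](subrK (a *: comb s)) -addrA -scalerBr -scalerBl.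
rewrite (le_lt_trans (ler_normD _ _))// (splitr e) ltr_leD// !normrZ.
  apply: (@le_lt_trans _ _ ((`|a| + 1) * `|u - comb s|)).
    by rewrite ler_wpM2r// lerDl.
  by rewrite mulrC -ltr_pdivlMr// ltr_wpDl.
apply: (@le_trans _ _ (d * (`|comb s| + 1))); last first.
  by rewrite divfK// gt_eqF// ltr_wpDl.
apply: ler_pM => //; last by rewrite lerDl.
by rewrite distrC ger0_norm ?subr_ge0 ?qa// lerBlDl ltW// qa.
Qed.

(** Otherwise a continuous functional vanishes on the closed span but not at
[h x]; composed with [h] it vanishes on a dense set, hence everywhere. *)
Let span_h x : span (h x).
Proof.
apply: contrapT => /existsNP[e /not_implyP[e0 /forallNP xe]].
have [||u su|f [fc f0 fx]] :=
  separate_subspace (z := h x) (e := e / 2) _ spanD spanZ.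
- by have := span_comb [::]; rewrite /comb big_nil.
- by rewrite divr_gt0.
- have [|s us] := su (e / 2); first by rewrite divr_gt0.
  have /negP := xe s; rewrite -leNgt => exs.
  rewrite -(lerD2r (e / 2)) -splitr (le_trans exs)//.
  rewrite (le_trans (ler_distD u _ _))// lerD2l.
  exact: ltW.
have cl : closed [set y | f (h y) = 0].
  by apply: (@closed_comp _ _ (f \o h) [set 0 : R^o]) => [y _|];
    [exact: h_cont | exact: closed_eq].
have : closure (range g) x by rewrite g_dense.
have gf : range g `<=` [set y | f (h y) = 0].
  move=> _ [i _ <-] /=; apply: f0.
  by have := span_comb [:: (1, i)]; rewrite /comb big_seq1 rmorph1 scale1r.
move=> /(closure_subset gf); rewrite closure_id in cl; rewrite -cl /= => fx0.
by rewrite fx0 ltxx in fx.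
Qed.

(** The functionals norming the rational combinations separate the points of the
closed span: the one that norms a combination closer to [d] than half the norm
of [d] is positive at [d]. The ordered form of separation comes from applying
this to [d = h y - h x] for each order of the two points. *)
Lemma countable_separation : exists f : seq (rat * I) -> X -> R,
  (forall s, continuous (f s : X -> R^o)) /\
  (forall x y, x <> y -> exists s, f s x < f s y).
Proof.
have [psi psiP] := choice (fun s => norming_functional (comb s)).
exists (fun s => psi s \o h); split=> [s|x y xy].
  by apply: h_cont; apply: dominated_continuous; exact: (psiP s).1.
pose d := h y - h x.
have d0 : 0 < `|d|.
  by rewrite normr_gt0 subr_eq0; apply/eqP => /h_inj/esym.
have sd : span d.
  by apply: spanD => //; rewrite -scaleN1r; exact: spanZ.
have [|s ds] := sd (`|d| / 2); first by rewrite divr_gt0.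
exists s; rewrite -subr_gt0 /= -linearB -/d.
have [psi_le psi_s] := psiP s.
have psi_d := psi_le (comb s - d); rewrite linearB/= psi_s distrC in psi_d.
have := ler_distD (comb s) d 0; rewrite !subr0.
move: psi_d ds; set q := psi s d : R; set a := `|d - _|; set b := `|comb s|.
set c := `|d|; lra.
Qed.

End separation.

(** For [x] in [D], the complement of an open set that isolates [x] is compact,
and is covered by the sets [f s > q] with [s] an index and [q] a rational such
that [f s x <= q]. A finite subcover is a code for [x] drawn from a countable
set. It covers all the other points of [D] but not [x], so distinct points have
distinct codes. *)
Lemma countable_discrete (R : realType) (X : ptopologicalType) (S : countType)
    (f : S -> X -> R) (D : set X) :
    compact [set: X] -> (forall s, continuous (f s : X -> R^o)) ->
    (forall x y, x <> y -> exists s, f s x < f s y) ->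
    (forall x, D x -> exists2 U, open U & D `&` U = [set x]) ->
  countable D.
Proof.
move=> Xc fc fsep Ddisc.
pose U (i : S * rat) := [set x | ratr i.2 < f i.1 x].
have oU i : open (U i).
  apply: (@open_comp _ _ (f i.1) [set r | ratr i.2 < r]) => [x _|].
    exact: fc.
  exact: open_gt.
have codeP x : exists c : {fset S * rat}, D x ->
    (forall i, i \in c -> ~ U i x) /\
    (forall y, D y -> y <> x -> exists2 i, i \in c & U i y).
  have [Dx|] := pselect (D x); last by exists fset0.
  have [V oV DV] := Ddisc x Dx.
  have : cover_compact (~` V).
    rewrite -compact_cover; apply: (subclosed_compact _ Xc) => //.
    exact: open_closedC.
  move=> /(_ _ [set i | ~ U i x] U (fun i _ => oU i)) [].
    move=> y Vy.
    have [|s xy] := fsep x y.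
      by move=> xy; apply: Vy; have [] : (D `&` V) y by rewrite DV.
    have [q /itvP qxy] := rat_in_itvoo xy.
    exists (s, q); last by rewrite /U /= qxy.
    by rewrite /U /= => /lt_gtF; rewrite qxy.
  move=> c cx cV; exists c => _; split=> [i /cx/set_mem//|y Dy yx].
  have [|i ic Uiy] := cV y; last by exists i.
  by move=> Vy; apply: yx; rewrite -[y = x]/([set x] y) -DV.
have [code codeE] := choice codeP.
apply/countable_injP; exists (fun x => choice.pickle (code x)) => x y.
move=> /set_mem Dx /set_mem Dy /(pcan_inj choice.pickleK) xy.
apply: contrapT => nxy; have [i ix Uiy] := (codeE x Dx).2 y Dy (nesym nxy).
by move: ix; rewrite xy => /(codeE y Dy).1.
Qed.

(** * The compactified Isbell-Mrowka space *)

Section mrowka_compactification.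
Variable A : set (set nat).
Local Notation X := (one_point_compactification (mrowka A)).

(** The point at infinity belongs to the family, so that density has only to be
checked at the points of [A]. *)
Definition mrowka_countable (i : option nat) : X :=
  omap (fun n => inl n : mrowka A) i.

Lemma mrowka_countable_dense : (forall B, A B -> infinite_set B) ->
  closure (range mrowka_countable) = [set: X].
Proof.
move=> Ainf; apply/seteqP; split=> // -[[n|B]|] _.
- by apply: subset_closure; exists (Some n).
- move=> U [F finF FU].
  have /infinite_setN0[n [Bn nF]] : infinite_set (set_val B `\` F).
    by apply: infinite_setD => //; apply: Ainf; exact: set_valP.
  exists (Some (inl n)); split; first by exists (Some n).
  by apply: FU; right; exists n.
- by apply: subset_closure; exists None.
Qed.

Lemma mrowka_discrete (x : X) :
  range (fun B : A => Some (inr B) : X) x ->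
  exists2 U : set X, open U &
    range (fun B : A => Some (inr B) : X) `&` U = [set x].
Proof.
move=> [B _ <-].
exists (Some @` ([set inr B] `|` range (inl : nat -> mrowka A))).
  apply: one_point_compactification_open_some; rewrite openE => p [->|[n _ <-]].
    exists set0; first exact: finite_set0.
    by move=> q [->|[n _ <-]]; [left|right; exists n].
  by right; exists n.
apply/seteqP; split=> [p [[C _ <-] [q [->|[n _ <-]]]]|p ->] //.
split; first by exists B.
by exists (inr B) => //; left.
Qed.

Lemma mrowka_not_eberlein (R : realType) :
  (forall B, A B -> infinite_set B) -> ~ countable A ->
  ~ eberlein_compact R X.
Proof.
move=> Ainf Auncount [E [K [_ [h [h' [hc _ hK _]]]]]].
pose k (x : X) : E := set_val (h x).
have kc (f : {linear E -> R^o}) : continuous f -> continuous (f \o k).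
  move=> fc x.
  have : (set_val \o h : X -> weak_space E) y @[y --> x] --> set_val (h x).
    apply: cvg_comp (hc x) _.
    exact: (@initial_continuous _ _ (set_val : K -> weak_space E)).
  have FF := fmap_filter (set_val \o h : X -> weak_space E) (nbhs_filter x).
  move=> /(@cvg_sup _ _ _ _ _ FF) /(_ (exist _ f fc)) hx.
  exact: cvg_comp hx (@initial_continuous _ _ (f : E -> R^o) _).
have kinj : injective k by move=> x y /val_inj/(can_inj hK).
have [f [fc fsep]] :=
  countable_separation kc kinj (mrowka_countable_dense Ainf).
have := countable_discrete one_point_compactification_compact fc fsep
  mrowka_discrete.
move=> /countable_injP[c cinj]; apply: Auncount; apply/countable_injP.
(* [c] codes the points of X; it is transported to sets of integers, with the
   dummy code 0 out of [A]. *)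
pose c' (B : set nat) := if pselect (A B) is left AB then
  c (Some (inr (SigSub (mem_set AB)))) else 0%N.
exists c' => B C /set_mem AB /set_mem AC; rewrite /c'.
case: pselect => // AB'; case: pselect => // AC'.
by move=> /(cinj _ _ (mem_set (imageT _ _)) (mem_set (imageT _ _))) [].
Qed.

End mrowka_compactification.

Theorem corollary12 (R : realType) (A : set (set nat))
    (A_ad : almost_disjoint A) (A_uncountable : ~ countable A)
    (Y : topologicalType) (Y_compact : compact [set: Y])
    (Y_hausdorff : hausdorff_space Y) (Y_scattered : scattered Y) :
  let X : topologicalType := one_point_compactification (mrowka A) in
  (forall T : {linear Cp R X -> Cp R Y},
      continuous T -> semi_embedding T -> embedding T) /\
  ~ eberlein_compact R X.
Proof.
move=> X; split=> [T Tcont Tsemi|]; first exact: semi_embedding_Cp.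
by apply: mrowka_not_eberlein => //; exact: A_ad.1.
Qed.
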